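(* Let $(W,S)$ be a Coxeter system (not necessarily finite) with set of positive roots $\Phi^+$. For any $A \subseteq \Phi^+$, we have $A \subseteq \overline{A}^{\mathrm{pbr}} \subseteq \overline{A}$, where $\overline{A}^{\mathrm{pbr}}$ is the palindromic Bruhat preclosure of $A$ and $\overline{A}$ is the $2$-closure of $A$.
   Context: Let $(W,S)$ be a Coxeter system with length function $\ell$, and let $\Phi$ be its root system (in the standard geometric representation on a real vector space $V$), with positive roots $\Phi^+$ with respect to $S$. For $\alpha\in\Phi$, $s_\alpha\in W$ denotes the reflection in $\alpha$. For $A\subseteq\Phi^+$, the palindromic Bruhat preclosure $\overline{A}^{\mathrm{pbr}}$ is the set of those $\alpha \in \Phi^+$ for which there exist $\alpha_1, \ldots, \alpha_m \in A$ such that $s_\alpha = s_{\alpha_1} \cdots s_{\alpha_m}$, $0 < \ell(s_{\alpha_1}) < \ell(s_{\alpha_1} s_{\alpha_2}) < \cdots < \ell(s_{\alpha_1} \cdots s_{\alpha_m})$, and the sequence is palindromic: $\alpha_r=\alpha_{m+1-r}$ for $1\le r\le m$. A subset $A \subseteq \Phi^+$ is $2$-closed if for all $\alpha, \beta \in A$ and $a, b \in \mathbb{R}_{\ge 0}$ such that $a \alpha + b \beta \in \Phi^+$, we have $a \alpha + b \beta \in A$. The $2$-closure $\overline{A}$ of $A \subseteq \Phi^+$ is the intersection of all $2$-closed subsets of $\Phi^+$ containing $A$. *)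

(* Defs.v *)
From HB Require Import structures.
From mathcomp Require Import all_boot all_order all_algebra.
From mathcomp Require Import all_classical all_reals.
From mathcomp Require Import topology normedtype trigo.
From mathcomp Require Import freeg.

Set Implicit Arguments.
Unset Strict Implicit.
Unset Printing Implicit Defensive.

Import Order.TTheory GRing.Theory Num.Theory.

Local Open Scope classical_set_scope.
Local Open Scope ring_scope.

Section CoxeterSystem.
Context (W : groupType).

(* The order of x, or 0 when x has infinite order. *)
Definition order_of (x : W) : nat :=
  xget 0%N [set n | (0 < n)%N /\ (x ^+ n)%g = 1%g /\
                    forall k, (0 < k)%N -> (x ^+ k)%g = 1%g -> (n <= k)%N].

Definition word_prod (S : set W) (u : seq S) : W := (\prod_(s <- u) val s)%g.

Definition cox_mx (S : set W) (s t : S) : nat := order_of (val s * val t)%g.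

(* S consists of involutions, generates W, and W is presented by the generators
   S with the relations (s t)^m(s,t) = 1 for m(s,t) finite; when m(s,t) is
   infinite it is encoded by 0, so that the corresponding relation is void.
   The case s = t contains the relations s^2 = 1. *)
Definition coxeter_system (S : set W) : Prop :=
  [/\ forall s : S, order_of (val s) = 2%N,
      forall w : W, exists u : seq S, word_prod u = w
    & forall (G : groupType) (f : S -> G),
        (forall s t : S, ((f s * f t) ^+ cox_mx s t)%g = 1%g) ->
        exists phi : {multiplicative W -> G}, forall s : S, phi (val s) = f s].

Definition ell (S : set W) (w : W) : nat :=
  xget 0%N [set n | (exists2 u : seq S, word_prod u = w & size u = n) /\
                    forall u : seq S, word_prod u = w -> (n <= size u)%N].

End CoxeterSystem.

Notation geom_space R S := {freeg (set_type S) / R}.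

Section RootSystem.
Context (R : realType) (W : groupType) (S : set W).

Local Notation geom_space := (geom_space R S).

Definition simple_root (s : S) : geom_space := << s >>.

Definition cox_form (s t : S) : R :=
  if cox_mx s t is m.+1 then - cos (pi / m.+1%:R) else - 1.

Definition bilin (v w : geom_space) : R :=
  \sum_(s <- dom v) \sum_(t <- dom w) coeff s v * coeff t w * cox_form s t.

Definition simple_refl (s : S) (v : geom_space) : geom_space :=
  v - (2 * bilin v (simple_root s)) *: simple_root s.

Definition is_geom_rep (rho : W -> geom_space -> geom_space) : Prop :=
  [/\ rho 1%g = id,
      forall w w', rho (w * w')%g = rho w \o rho w'
    & forall s : S, rho (val s) = simple_refl s].

(* For a Coxeter system, is_geom_rep is satisfied by exactly one rho (Tits);
   the default value is irrelevant. *)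
Definition geom_rep : W -> geom_space -> geom_space :=
  @xget (W -> geom_space -> geom_space) (fun=> id) [set rho | is_geom_rep rho].

Definition roots : set geom_space :=
  [set a | exists w s, a = geom_rep w (simple_root s)].

Definition pos_roots : set geom_space :=
  [set a | roots a /\ forall s : S, 0 <= coeff s a].

(* If a = w(a_s) with s simple, then s_a = w s w^-1; this does not depend on
   the choice of w and s, and the default value is used only off the roots. *)
Definition refl (a : geom_space) : W :=
  xget 1%g [set r | exists w (s : S), a = geom_rep w (simple_root s) /\
                                      r = (w * val s * w^-1)%g].

Definition pbr_closure (A : set geom_space) : set geom_space :=
  [set a | pos_roots a /\
    exists b : seq geom_space,
      [/\ forall c, c \in b -> A c,
          refl a = (\prod_(c <- b) refl c)%g,
          path ltn 0%N [seq ell S (\prod_(c <- take r b) refl c)%g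
                     | r <- iota 1 (size b)]
        & rev b = b]].

Definition two_closed (A : set geom_space) : Prop :=
  forall a b : geom_space, A a -> A b -> forall x y : R, 0 <= x -> 0 <= y ->
    pos_roots (x *: a + y *: b) -> A (x *: a + y *: b).

Definition two_closure (A : set geom_space) : set geom_space :=
  \bigcap_(C in [set C | C `<=` pos_roots /\ two_closed C /\ A `<=` C]) C.

End RootSystem.

(* Main.v *)
(* Let s_alpha = s_1 ... s_m be a palindromic chain, with s_i the reflection in
   alpha_i, and x_r = s_1 ... s_r. Then m = 2 k + 1, since otherwise s_alpha = 1,
   and x_(m-r) = s_alpha x_r. Put beta_r = x_r^-1 alpha. For r <= k, x_r is
   shorter than s_alpha x_r, so beta_r is a positive root; at the middle of the
   palindrome, beta_k = alpha_(k+1). With gamma = x_r alpha_(r+1), the increasing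
   lengths give gamma > 0 and s_alpha gamma < 0, hence
   (beta_r, alpha_(r+1)) = (alpha, gamma) > 0. So beta_r is beta_(r+1) plus a
   nonnegative multiple of alpha_(r+1), and descending from beta_k to
   beta_0 = alpha never leaves a 2-closed set containing the alpha_i.
   This rests on Tits' theorem that lengths detect the signs of roots. *)
From HB Require Import structures.
Require Import Defs.
From mathcomp Require Import all_boot all_order all_algebra.
From mathcomp Require Import all_classical all_reals.
From mathcomp Require Import topology normedtype trigo.
From mathcomp Require Import freeg.
From mathcomp Require Import zify ring.

Set Implicit Arguments.
Unset Strict Implicit.
Unset Printing Implicit Defensive.

Import Order.TTheory GRing.Theory Num.Theory.

Local Open Scope classical_set_scope.
Local Open Scope ring_scope.

(** * Orders of group elements *)

Section Order.
Context (W : groupType).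
Implicit Types x y : W.

Lemma order_of_exp x : (x ^+ order_of x)%g = 1%g.
Proof. by rewrite /order_of; case: xgetP => [n _ [_ []]|]. Qed.

Lemma order_of_eqP x n : (0 < n)%N -> (x ^+ n)%g = 1%g ->
  (forall k, (0 < k)%N -> (x ^+ k)%g = 1%g -> (n <= k)%N) -> order_of x = n.
Proof.
move=> n0 xn nmin; rewrite /order_of.
case: xgetP => [k _ [k0 [xk kmin]]|/(_ n)]; last by case.
by apply/eqP; rewrite eqn_leq kmin// nmin.
Qed.

Lemma order_of1 : order_of (1 : W)%g = 1%N.
Proof. by apply: order_of_eqP => //; rewrite expg1. Qed.

Lemma order_of_inv x : order_of (x^-1)%g = order_of x.
Proof.
rewrite /order_of; congr xget; apply/seteqP; split=> n [n0 [xn nmin]].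
  split=> //; split; first by apply: (@invg_inj W); rewrite -expVgn invg1.
  by move=> k k0 xk; apply: nmin => //; rewrite expVgn xk invg1.
split=> //; split; first by rewrite expVgn xn invg1.
by move=> k k0 xk; apply: nmin => //; apply: (@invg_inj W); rewrite -expVgn invg1.
Qed.

End Order.

(* The permutations of T form the target group to which the universal property
   of the Coxeter presentation is applied. *)
Record bijection (T : Type) := Bijection {
  bfun :> T -> T;
  binv : T -> T;
  bfunK : cancel bfun binv;
  binvK : cancel binv bfun }.

(** * The group of permutations of a type *)

Section BijectionGroup.
Context (T : Type).
Implicit Types f g h : bijection T.

Lemma bijection_eq f g : f =1 g -> f = g.
Proof.
case: f g => f f' fK f'K [g g' gK g'K] /= /funext fg.
rewrite -{}fg in gK g'K *.
have fg' : f' = g' by apply/funext => x; rewrite -[x in LHS]g'K fK.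
rewrite -{}fg' in gK g'K *.
by rewrite (Prop_irrelevance fK gK) (Prop_irrelevance f'K g'K).
Qed.

Definition bij_one := @Bijection T id id (fun=> erefl) (fun=> erefl).
Definition bij_inv f := Bijection (@binvK T f) (@bfunK T f).
Definition bij_mul f g :=
  Bijection (can_comp (@bfunK T f) (@bfunK T g))
            (can_comp (@binvK T g) (@binvK T f)).

HB.instance Definition _ := gen_eqMixin (bijection T).
HB.instance Definition _ := gen_choiceMixin (bijection T).

Fact bij_mulA : associative bij_mul.
Proof. by move=> f g h; apply: bijection_eq. Qed.
Fact bij_mul1 : left_id bij_one bij_mul.
Proof. by move=> f; apply: bijection_eq. Qed.
Fact bij_1mul : right_id bij_one bij_mul.
Proof. by move=> f; apply: bijection_eq. Qed.
Fact bij_mulV : left_inverse bij_one bij_inv bij_mul.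
Proof. by move=> f; apply: bijection_eq => x /=; rewrite bfunK. Qed.
Fact bij_Vmul : right_inverse bij_one bij_inv bij_mul.
Proof. by move=> f; apply: bijection_eq => x /=; rewrite binvK. Qed.

HB.instance Definition _ := isGroup.Build (bijection T)
  bij_mulA bij_mul1 bij_1mul bij_mulV bij_Vmul.

Lemma bijM f g x : (f * g)%g x = f (g x). Proof. by []. Qed.

Lemma bijX f n x : (f ^+ n)%g x = iter n f x.
Proof. by elim: n => [|n IHn] //=; rewrite expgS bijM IHn. Qed.

End BijectionGroup.

(** * Sums over the support of a vector *)

Section DomSum.
Context (R : realType) (K : choiceType).
Implicit Types (f : K -> R) (v : {freeg K / R}).

Lemma sum_dom f v r : uniq r -> {subset dom v <= r} ->
  \sum_(s <- dom v) coeff s v * f s = \sum_(s <- r) coeff s v * f s.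
Proof.
move=> ur sr; rewrite [RHS](bigID (mem (dom v))) /= [X in _ + X]big1 ?addr0.
  rewrite -[RHS]big_filter; apply: perm_big; apply: uniq_perm.
  - exact: uniq_dom.
  - exact: filter_uniq.
  - by move=> s; rewrite mem_filter /=; case: (boolP (s \in dom v)) => // /sr ->.
by move=> s /coeff_outdom ->; rewrite mul0r.
Qed.

(** The three supports differ, so all sums are first taken over one list containing them. This
    yields the linearity of [bilin]. *)
Lemma sum_dom_linear f a u v :
  \sum_(s <- dom (a *: u + v)) coeff s (a *: u + v) * f s =
  a * \sum_(s <- dom u) coeff s u * f s + \sum_(s <- dom v) coeff s v * f s.
Proof.
pose r := undup (dom u ++ dom v ++ dom (a *: u + v)).
rewrite !(@sum_dom f _ r) ?undup_uniq//; try by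
  move=> s sD; rewrite mem_undup !mem_cat sD ?orbT.
rewrite mulr_sumr -big_split; apply: eq_bigr => s _ /=.
by rewrite coeffD coeffZ mulrDl mulrA.
Qed.

End DomSum.

(** * Chebyshev polynomials *)

Section Chebyshev.
Context (R : realType).
Implicit Types c : R.

(* The Chebyshev polynomials of the second kind, shifted by one:
   cheb (cos x) k = sin (k x) / sin x. *)
Fixpoint cheb c (k : nat) : R :=
  if k is k'.+1 then
    if k' is k''.+1 then 2 * c * cheb c k' - cheb c k'' else 1
  else 0.

Lemma chebSS c k : cheb c k.+2 = 2 * c * cheb c k.+1 - cheb c k.
Proof. by []. Qed.

Lemma cheb_ind2 (P : nat -> Prop) :
  P 0%N -> P 1%N -> (forall k, P k -> P k.+1 -> P k.+2) -> forall k, P k.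
Proof.
move=> P0 P1 PS k; suff [] : P k /\ P k.+1 by [].
by elim: k => // k [? ?]; split=> //; apply: PS.
Qed.

Lemma cheb1 k : cheb 1 k = k%:R.
Proof.
elim/cheb_ind2: k => // k IH0 IH1.
by rewrite chebSS IH0 IH1 -!natr1; ring.
Qed.

Lemma cheb_cos (x : R) k : sin x * cheb (cos x) k = sin (k%:R * x).
Proof.
elim/cheb_ind2: k => [||k IH0 IH1]; first by rewrite mulr0 mul0r sin0.
  by rewrite mulr1 mul1r.
rewrite chebSS mulrBr mulrCA IH0 IH1 -!natr1.
have -> : (k%:R + 1 + 1) * x = (k%:R * x + x) + x by ring.
have -> : (k%:R + 1) * x = k%:R * x + x by ring.
rewrite !sinD cosD.
have := cos2Dsin2 x.
set a := sin x; set b := cos x; set p := sin (_ * x); set q := cos (_ * x).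
(* After the addition formulas the two sides differ by a multiple of cos^2 + sin^2 - 1. *)
move=> h; apply: subr0_eq; transitivity (p * (b ^+ 2 + a ^+ 2 - 1)); first ring.
by rewrite h subrr mulr0.
Qed.

Lemma sin_pi_div_gt0 m : (1 < m)%N -> 0 < sin (pi / m%:R : R).
Proof.
move=> m1; have m0 : 0 < m%:R :> R by rewrite ltr0n ltnW.
apply: sin_gt0_pi; rewrite divr_gt0 ?pi_gt0//=.
by rewrite ltr_pdivrMr// ltr_pMr ?pi_gt0// ltr1n.
Qed.

(** Multiplying by sin (pi / m) > 0 gives sin (k pi / m), whose angle lies in [0, pi]. *)
Lemma cheb_ge0 m k : (1 < m)%N -> (k <= m)%N -> 0 <= cheb (cos (pi / m%:R)) k.
Proof.
move=> m1 km; rewrite -(pmulr_rge0 _ (sin_pi_div_gt0 m1)) cheb_cos.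
have m0 : 0 < m%:R :> R by rewrite ltr0n ltnW.
apply: sin_ge0_pi; rewrite mulr_ge0 ?ler0n ?divr_ge0 ?pi_ge0 ?ler0n//=.
by rewrite mulrCA ler_piMr ?pi_ge0// ler_pdivrMr// mul1r ler_nat.
Qed.

(** For k = 2 m the angle k pi / m is 2 pi. The two values will be the coordinates of (s t)^m
    alpha_s in the plane of the two simple roots. *)
Lemma cheb_double m : (1 < m)%N ->
  cheb (cos (pi / m%:R)) m.*2 = 0 /\ cheb (cos (pi / m%:R)) m.*2.+1 = 1.
Proof.
move=> m1; have s0 := sin_pi_div_gt0 m1.
have m0 : m%:R != 0 :> R by rewrite pnatr_eq0 -lt0n ltnW.
have e : (m.*2)%:R * (pi / m%:R) = pi *+ 2 :> R.
  by rewrite -muln2 natrM mulrCA (mulrC m%:R) mulfK// mulr_natr.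
split; apply: (mulfI (lt0r_neq0 s0)); rewrite cheb_cos.
  by rewrite e sin2pi mulr0.
by rewrite -natr1 mulrDl e mul1r addrC sinD2pi mulr1.
Qed.

End Chebyshev.

Ltac freeg_ring :=
  apply/eqP/freeg_eqP => ?;
  rewrite ?(coeffD, coeffB, coeffN, coeffZ, coeff0); ring.

(** * Alternating words in two letters *)

Section Alternating.
Context (T : Type).
Implicit Types s t : T.

(* The alternating word of length k in s and t whose last letter is t. *)
Fixpoint alt s t (k : nat) : seq T :=
  if k is k'.+1 then (if odd k' then s else t) :: alt s t k' else [::].

Lemma size_alt s t k : size (alt s t k) = k.
Proof. by elim: k => //= k ->. Qed.

Lemma rcons_alt s t k : rcons (alt s t k) s = alt t s k.+1.
Proof. by elim: k => //= k ->; case: (odd k). Qed.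

(** Letters are chosen by parity counted from the right end, so every suffix is again an [alt] word
    in the same s and t. *)
Lemma alt_cat s t i j : exists2 u, size u = i & alt s t (i + j) = u ++ alt s t j.
Proof.
elim: i => [|i [u su eu]]; first by exists [::].
exists ((if odd (i + j) then s else t) :: u) => /=; first by rewrite su.
by rewrite eu.
Qed.

End Alternating.

(** * The bilinear form and its reflections *)

Section Reflection.
Context (R : realType) (W : groupType) (S : set W).
Hypothesis WS : coxeter_system S.
Local Notation V := (geom_space R S).
Implicit Types (s t : S) (u v w b : V) (a c : R).

Lemma val_sq s : (val s * val s = 1)%g.
Proof. 
have [So _ _] := WS; have := order_of_exp (val s).
by rewrite So expgS expg1.
Qed.

Lemma valV s : ((val s)^-1 = val s)%g.
Proof. by apply: (@mulgI _ (val s)); rewrite mulgV val_sq. Qed.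

Lemma val_neq1 s : val s != 1%g.
Proof.
have [So _ _] := WS; apply/eqP => s1.
by have := So s; rewrite s1 order_of1.
Qed.

Lemma cox_mxC s t : cox_mx s t = cox_mx t s.
Proof. by rewrite /cox_mx -order_of_inv invgM !valV. Qed.

Lemma cox_mxss s : cox_mx s s = 1%N.
Proof. by rewrite /cox_mx val_sq order_of1. Qed.

Lemma cox_mx_neq1 s t : s != t -> cox_mx s t != 1%N.
Proof.
apply: contra => /eqP m1; have := order_of_exp (val s * val t)%g.
rewrite [order_of _]m1 expg1 => st1.
by apply/eqP/val_inj; rewrite -[val s]valV; apply: mulg1_eq.
Qed.

Lemma cox_formC s t : cox_form R s t = cox_form R t s.
Proof. by rewrite /cox_form cox_mxC. Qed.

Lemma cox_formss s : cox_form R s s = 1.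
Proof. by rewrite /cox_form cox_mxss divr1 cospi opprK. Qed.

Lemma bilinE u v : bilin u v =
  \sum_(s <- dom u) coeff s u * \sum_(t <- dom v) coeff t v * cox_form R s t.
Proof.
apply: eq_bigr => s _; rewrite mulr_sumr.
by apply: eq_bigr => t _; rewrite mulrA.
Qed.

Lemma bilinC u v : bilin u v = bilin v u.
Proof.
rewrite /bilin exchange_big; apply: eq_bigr => s _; apply: eq_bigr => t _.
by rewrite cox_formC [coeff _ u * _]mulrC.
Qed.

Lemma bilinPl a u v w : bilin (a *: u + v) w = a * bilin u w + bilin v w.
Proof. by rewrite !bilinE sum_dom_linear. Qed.

Lemma bilinDl u v w : bilin (u + v) w = bilin u w + bilin v w.
Proof. by rewrite -{1}[u]scale1r bilinPl mul1r. Qed.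

Lemma bilin0l w : bilin 0 w = 0.
Proof. by apply: (addrI (bilin 0 w)); rewrite -bilinDl !addr0. Qed.

Lemma bilinZl a u w : bilin (a *: u) w = a * bilin u w.
Proof. by rewrite -[a *: u]addr0 bilinPl bilin0l addr0. Qed.

Lemma bilinNl u w : bilin (- u) w = - bilin u w.
Proof. by rewrite -scaleN1r bilinZl mulN1r. Qed.

Lemma bilinBl u v w : bilin (u - v) w = bilin u w - bilin v w.
Proof. by rewrite bilinDl bilinNl. Qed.

Lemma bilinDr u v w : bilin w (u + v) = bilin w u + bilin w v.
Proof. by rewrite !(bilinC w) bilinDl. Qed.

Lemma bilinZr a u w : bilin w (a *: u) = a * bilin w u.
Proof. by rewrite !(bilinC w) bilinZl. Qed.

Lemma bilinNr u w : bilin w (- u) = - bilin w u.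
Proof. by rewrite !(bilinC w) bilinNl. Qed.

Lemma bilinBr u v w : bilin w (u - v) = bilin w u - bilin w v.
Proof. by rewrite bilinDr bilinNr. Qed.

Lemma bilin_simple s t :
  bilin (simple_root R s) (simple_root R t) = cox_form R s t.
Proof. by rewrite /bilin !domU1 !big_seq1 !coeffU !eqxx !mul1r. Qed.

Lemma bilin_simple1 s : bilin (simple_root R s) (simple_root R s) = 1.
Proof. by rewrite bilin_simple cox_formss. Qed.

(** When [bilin b b = 1], as for every root, this is the orthogonal reflection negating b. *)
Definition reflv b v : V := v - (2 * bilin v b) *: b.

Lemma simple_reflE s v : simple_refl s v = reflv (simple_root R s) v.
Proof. by []. Qed.

Lemma reflvP b a u v : reflv b (a *: u + v) = a *: reflv b u + reflv b v.
Proof.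
by rewrite /reflv bilinPl; freeg_ring.
Qed.

Lemma reflvZ b a u : reflv b (a *: u) = a *: reflv b u.
Proof. by rewrite /reflv bilinZl; freeg_ring. Qed.

Lemma reflv_bilin b u v : bilin b b = 1 ->
  bilin (reflv b u) (reflv b v) = bilin u v.
Proof.
move=> b1; rewrite !(bilinBl, bilinBr, bilinZl, bilinZr) b1 (bilinC b); ring.
Qed.

Lemma reflv_self b : bilin b b = 1 -> reflv b b = - b.
Proof.
by move=> b1; rewrite /reflv b1; freeg_ring.
Qed.

Lemma reflvK b : bilin b b = 1 -> involutive (reflv b).
Proof.
move=> b1 v; rewrite {1}/reflv [bilin (reflv b v) b]bilinBl bilinZl b1.
by rewrite /reflv; freeg_ring.
Qed.

Definition act (u : seq S) (v : V) : V := foldr (@simple_refl R W S) v u.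

Lemma simple_reflK s : involutive (@simple_refl R W S s).
Proof. exact: reflvK (bilin_simple1 s). Qed.

Lemma simple_refl_root s t : simple_refl s (simple_root R t) =
  simple_root R t - (2 * cox_form R s t) *: simple_root R s.
Proof. by rewrite /simple_refl bilin_simple cox_formC. Qed.

(** With c minus the form of the two roots, a new first letter x turns A y + B x into A y + (2 c A -
    B) x, which is the recursion of [cheb]. *)
Lemma act_alt s t k : act (alt s t k) (simple_root R s) =
  cheb (- cox_form R s t) k.+1 *: simple_root R (if odd k then t else s) +
  cheb (- cox_form R s t) k *: simple_root R (if odd k then s else t).
Proof.
set c := - _.
have cE x y : (x = s /\ y = t) \/ (x = t /\ y = s) -> cox_form R x y = - c.
  by rewrite opprK => -[[-> ->]|[-> ->]] //; rewrite cox_formC.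
elim: k => [|k IHk]; first by rewrite scale1r scale0r addr0.
rewrite [act _ _]/= IHk.
set x := if odd k then s else t; set y := if odd k then t else s.
have -> : (if odd k.+1 then t else s) = x by rewrite /x /=; case: odd.
have -> : (if odd k.+1 then s else t) = y by rewrite /y /=; case: odd.
rewrite simple_reflE reflvP reflvZ reflv_self ?bilin_simple1//.
rewrite -simple_reflE simple_refl_root cE; last by rewrite /x /y; case: odd; auto.
rewrite chebSS; freeg_ring.
Qed.

End Reflection.

(** * The geometric representation *)

Section GeomRep.
Context (R : realType) (W : groupType) (S : set W).
Hypothesis WS : coxeter_system S.
Local Notation V := (geom_space R S).
Local Notation srefl := (@simple_refl R W S).
Local Notation simple := (simple_root R).
Implicit Types (s t : S) (u v b : V) (a c : R) (w : W).

Lemma cox_form_cos s t : (0 < cox_mx s t)%N ->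
  - cox_form R s t = cos (pi / (cox_mx s t)%:R).
Proof. by rewrite /cox_form; case: cox_mx => //= m _; rewrite opprK. Qed.

Lemma cox_form_infty s t : cox_mx s t = 0%N -> - cox_form R s t = 1.
Proof. by rewrite /cox_form => ->; rewrite opprK. Qed.

Lemma act_alt_double s t k v :
  act (alt s t k.*2) v = iter k (srefl s \o srefl t) v.
Proof. by elim: k => //= k ->; rewrite odd_double. Qed.

Lemma iter_refl_linear s t k a u v :
  iter k (srefl s \o srefl t) (a *: u + v) =
  a *: iter k (srefl s \o srefl t) u + iter k (srefl s \o srefl t) v.
Proof. by elim: k => //= k ->; rewrite !simple_reflE !reflvP. Qed.

Lemma iter_refl_simple s t : (1 < cox_mx s t)%N ->
  iter (cox_mx s t) (srefl s \o srefl t) (simple s) = simple s.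
Proof.
move=> m1; rewrite -act_alt_double (act_alt R WS) cox_form_cos 1?ltnW//.
have [-> ->] := cheb_double R m1.
by rewrite odd_double scale1r scale0r addr0.
Qed.

(* On the plane of the two simple roots this is the Chebyshev computation; for
   1 < m < oo the form is nondegenerate there, and the orthogonal complement of
   the plane is fixed. *)
Lemma coxeter_relation s t v :
  iter (cox_mx s t) (srefl s \o srefl t) v = v.
Proof.
have [->|st] := eqVneq s t.
  by rewrite (cox_mxss WS) /= (simple_reflK WS).
have [->//|m0] := posnP (cox_mx s t).
have m1 : (1 < cox_mx s t)%N.
  by rewrite ltn_neqAle eq_sym (cox_mx_neq1 WS st).
set m := cox_mx s t in m0 m1 *; set f := srefl s \o srefl t.
have fs : iter m f (simple s) = simple s by exact: iter_refl_simple.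
have ft : iter m f (simple t) = simple t.
  (* [g] is the inverse of [f]. With s and t exchanged, its m-th iterate fixes the root of t, hence
     so does that of [f]. *)
  pose g := srefl t \o srefl s.
  have fg : cancel g f by move=> x; rewrite /f /g /= !(simple_reflK WS).
  have fgm k : cancel (iter k g) (iter k f).
    by elim: k => // k IHk x; rewrite iterSr iterS fg IHk.
  have gt : iter m g (simple t) = simple t.
    by rewrite /m (cox_mxC WS) iter_refl_simple// (cox_mxC WS).
  by rewrite -[in LHS]gt fgm.
have fP k a x y : iter k f (a *: x + y) = a *: iter k f x + iter k f y.
  exact: iter_refl_linear.
have [c cE] : exists c, cox_form R s t = - c.
  by exists (- cox_form R s t); rewrite opprK.
have c1 : 1 - c ^+ 2 != 0.
  rewrite -(opprK c) -cE cox_form_cos// -sin2cos2 expf_neq0//.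
  by rewrite gt_eqF// sin_pi_div_gt0.
(* [x] and [y] solve the Gram system, of determinant 1 - c^2, that makes [q] orthogonal to both
   simple roots. *)
pose x := (bilin v (simple s) + c * bilin v (simple t)) / (1 - c ^+ 2).
pose y := (bilin v (simple t) + c * bilin v (simple s)) / (1 - c ^+ 2).
pose q := v - x *: simple s - y *: simple t.
have qs : bilin q (simple s) = 0.
  rewrite !bilinBl !bilinZl !bilin_simple (cox_formss R WS) (cox_formC R WS t) cE.
  by rewrite /x /y; field.
have qt : bilin q (simple t) = 0.
  rewrite !bilinBl !bilinZl !bilin_simple (cox_formss R WS) cE.
  by rewrite /x /y; field.
have fq k : iter k f q = q.
  elim: k => //= k ->; rewrite /f /= /simple_refl qt mulr0 scale0r subr0 qs.
  by rewrite mulr0 scale0r subr0.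
have -> : v = x *: simple s + (y *: simple t + q) by rewrite /q; freeg_ring.
by rewrite !fP fs ft fq.
Qed.

(** The simple reflections satisfy the Coxeter relations, so the universal property maps W to the
    permutations of V. *)
Lemma is_geom_rep_exists : exists rho, @is_geom_rep R W S rho.
Proof.
have [So gen univ] := WS.
pose f s := Bijection (@simple_reflK R W S WS s) (@simple_reflK R W S WS s).
have [s t|phi phiE] := univ (bijection V) f.
  by apply: bijection_eq => v; rewrite bijX; apply: coxeter_relation.
exists (fun x => bfun (phi x)); split.
- have -> : phi 1%g = 1%g by apply: (@mulgI _ (phi 1%g)); rewrite -gmulfM !mulg1.
  by [].
- by move=> x y; rewrite gmulfM.
- by move=> s; rewrite phiE.
Qed.

Lemma geom_repP : is_geom_rep (@geom_rep R W S).
Proof. exact: xgetPex is_geom_rep_exists. Qed.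

Local Notation rho := (@geom_rep R W S).

Lemma geom_rep1 v : rho 1%g v = v.
Proof. by have [-> _ _] := geom_repP. Qed.

Lemma geom_repM x y v : rho (x * y)%g v = rho x (rho y v).
Proof. by have [_ -> _] := geom_repP. Qed.

Lemma geom_rep_simple s v : rho (val s) v = srefl s v.
Proof. by have [_ _ ->] := geom_repP. Qed.

Lemma geom_repK x : cancel (rho x) (rho x^-1%g).
Proof. by move=> v; rewrite -geom_repM mulVg geom_rep1. Qed.

Lemma geom_repVK x : cancel (rho x^-1%g) (rho x).
Proof. by move=> v; rewrite -geom_repM mulgV geom_rep1. Qed.

Lemma word_prod_nil : word_prod ([::] : seq S) = 1%g.
Proof. by rewrite /word_prod big_nil. Qed.

Lemma word_prod_cons s (x : seq S) :
  word_prod (s :: x) = (val s * word_prod x)%g.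
Proof. by rewrite /word_prod big_cons. Qed.

Lemma word_prod_cat (x y : seq S) :
  word_prod (x ++ y) = (word_prod x * word_prod y)%g.
Proof. by rewrite /word_prod big_cat. Qed.

Lemma word_prod_rcons (x : seq S) s :
  word_prod (rcons x s) = (word_prod x * val s)%g.
Proof. by rewrite -cats1 word_prod_cat word_prod_cons word_prod_nil mulg1. Qed.

Lemma word_prod_rev (x : seq S) : word_prod (rev x) = ((word_prod x)^-1)%g.
Proof.
elim: x => [|s x IHx]; first by rewrite word_prod_nil invg1.
by rewrite rev_cons word_prod_rcons IHx word_prod_cons invgM (valV WS).
Qed.

Lemma geom_rep_word (x : seq S) v : rho (word_prod x) v = act x v.
Proof.
elim: x => [|s x IHx]; first by rewrite word_prod_nil geom_rep1.
by rewrite word_prod_cons geom_repM IHx geom_rep_simple.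
Qed.

(** The homomorphism was built with values in all permutations, so linearity is recovered from the
    generators. *)
Lemma geom_repP_linear w a u v : rho w (a *: u + v) = a *: rho w u + rho w v.
Proof.
have [_ gen _] := WS; have [x <-] := gen w.
by rewrite !geom_rep_word; elim: x => //= s x ->; rewrite !simple_reflE !reflvP.
Qed.

Lemma geom_rep0 w : rho w 0 = 0.
Proof.
apply: (addrI (rho w 0)).
by rewrite -{1}[rho w 0]scale1r -geom_repP_linear !addr0 scale1r.
Qed.

Lemma geom_repZ w a v : rho w (a *: v) = a *: rho w v.
Proof. by rewrite -[a *: v]addr0 geom_repP_linear geom_rep0 addr0. Qed.

Lemma geom_repD w u v : rho w (u + v) = rho w u + rho w v.
Proof. by rewrite -{1}[u]scale1r geom_repP_linear scale1r. Qed.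

Lemma geom_repN w v : rho w (- v) = - rho w v.
Proof. by rewrite -scaleN1r geom_repZ scaleN1r. Qed.

Lemma geom_rep_bilin w u v : bilin (rho w u) (rho w v) = bilin u v.
Proof.
have [_ gen _] := WS; have [x <-] := gen w.
rewrite !geom_rep_word; elim: x => //= s x <-.
exact: (reflv_bilin WS _ _ (bilin_simple1 R WS s)).
Qed.

Lemma geom_rep_reflv w b v : rho w (reflv b v) = reflv (rho w b) (rho w v).
Proof.
by rewrite /reflv geom_repD geom_repN geom_repZ geom_rep_bilin.
Qed.

End GeomRep.

(** * Lengths and signs of roots *)

Section Length.
Context (R : realType) (W : groupType) (S : set W).
Hypothesis WS : coxeter_system S.
Local Notation V := (geom_space R S).
Local Notation simple := (simple_root R).
Local Notation rho := (@geom_rep R W S).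
Local Notation l := (@ell W S).
Implicit Types (s t : S) (u v b : V) (w : W) (x y : seq S).

(** Every w has a word, hence a shortest one, so the default value in [ell] never intervenes. *)
Lemma ellP w : (exists2 x : seq S, word_prod x = w & size x = l w) /\
  forall x, word_prod x = w -> (l w <= size x)%N.
Proof.
rewrite /ell; set P := [set n | _]; apply: (@xgetPex _ 0%N P).
have [_ gen _] := WS.
have ex : exists n, `[< exists2 x : seq S, word_prod x = w & size x = n >].
  by have [x xw] := gen w; exists (size x); apply/asboolP; exists x.
exists (ex_minn ex); case: ex_minnP => n /asboolP hn nmin; split=> // x xw.
by apply: nmin; apply/asboolP; exists x.
Qed.

Lemma ell_word w : exists2 x : seq S, word_prod x = w & size x = l w.
Proof. by case: (ellP w). Qed.

Lemma ell_word_le x : (l (word_prod x) <= size x)%N.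
Proof. by have [_] := ellP (word_prod x); apply. Qed.

Lemma ell1 : l 1%g = 0%N.
Proof.
by apply/eqP; rewrite -leqn0 -(word_prod_nil S) (leq_trans (ell_word_le _)).
Qed.

Lemma ell_eq0 w : l w = 0%N -> w = 1%g.
Proof.
by have [x <- <-] := ell_word w; move/size0nil ->; rewrite word_prod_nil.
Qed.

Lemma ell_mul_word w x : (l (w * word_prod x) <= l w + size x)%N.
Proof.
have [y <- <-] := ell_word w.
by rewrite -word_prod_cat -size_cat ell_word_le.
Qed.

Lemma ellV w : l w^-1%g = l w.
Proof.
have le z : (l z^-1%g <= l z)%N.
  by have [x <- <-] := ell_word z; rewrite -(word_prod_rev WS) -size_rev ell_word_le.
by apply/eqP; rewrite eqn_leq le -{1}[w]invgK le.
Qed.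

Lemma mulg_valK w s : (w * val s * val s)%g = w.
Proof. by rewrite -mulgA (val_sq WS) mulg1. Qed.

(** Take for s the last letter of a shortest word. The remaining prefix is again shortest, since a
    letter adds at most one to the length. *)
Lemma ell_descent w : (0 < l w)%N ->
  exists2 s, l w = (l (w * val s)%g).+1 &
    exists2 x : seq S, word_prod (rcons x s) = w & size x = l (w * val s)%g.
Proof.
have [x] := ell_word w; case/lastP: x => [|x s] xw szx; first by rewrite -szx.
have e : word_prod x = (w * val s)%g.
  by rewrite -xw word_prod_rcons mulg_valK.
have szs : size x = l (w * val s)%g.
  apply/eqP; rewrite eqn_leq -{2}e ell_word_le andbT.
  have := ell_mul_word (w * val s)%g [:: s].
  by rewrite word_prod_cons word_prod_nil mulg1 mulg_valK -szx size_rcons addn1.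
by exists s; [rewrite -szx size_rcons szs | exists x].
Qed.

Lemma word_alt_double s t k :
  word_prod (alt s t k.*2) = ((val s * val t) ^+ k)%g.
Proof.
elim: k => [|k IHk]; first by rewrite word_prod_nil.
by rewrite doubleS /= odd_double !word_prod_cons IHk expgS mulgA.
Qed.

(* The alternating word of length m + 1 equals the inverse of the remaining
   m - 1 letters of the relator of length 2 m. *)
Lemma ell_alt_le s t k : (0 < cox_mx s t)%N -> (cox_mx s t <= k)%N ->
  exists2 y : seq S, word_prod (alt t s k.+1) = word_prod y & (size y < k)%N.
Proof.
move=> m0 mk; set m := cox_mx s t in m0 mk *.
have relm : ((val t * val s) ^+ m)%g = 1%g.
  by rewrite /m (cox_mxC WS) order_of_exp.
have [u su eu] := alt_cat t s (k - m) m.+1.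
have [u' su' eu'] := alt_cat t s m.-1 m.+1.
move: eu'; have -> : (m.-1 + m.+1 = m.*2)%N by lia.
have -> : k.+1 = (k - m + m.+1)%N by lia.
move=> /(congr1 (@word_prod W S)); rewrite word_alt_double word_prod_cat.
rewrite relm => /esym e.
exists (u ++ rev u'); last by rewrite size_cat size_rev su su'; lia.
rewrite eu !word_prod_cat (word_prod_rev WS); congr (_ * _)%g.
by apply: (@mulgI _ (word_prod u')); rewrite e mulgV.
Qed.

Definition nneg (v : V) := forall s, 0 <= coeff s v.

Lemma nnegD u v : nneg u -> nneg v -> nneg (u + v).
Proof. by move=> hu hv s; rewrite coeffD addr_ge0. Qed.

Lemma nnegZ (a : R) v : 0 <= a -> nneg v -> nneg (a *: v).
Proof. by move=> a0 hv s; rewrite coeffZ mulr_ge0. Qed.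

Lemma nneg_simple s : nneg (simple s).
Proof. by move=> t; rewrite coeffU mul1r ler0n. Qed.

Lemma nneg_anti v : nneg v -> nneg (- v) -> v = 0.
Proof.
move=> v0 Nv0; apply/eqP/freeg_eqP => s; rewrite coeff0; apply/eqP.
by rewrite eq_le v0 andbT -oppr_ge0 -coeffN Nv0.
Qed.

(** These are the coefficients in [act_alt]: k itself for infinite order, otherwise a quotient of
    sines of angles up to pi. *)
Lemma cheb_cox_ge0 s t k : s != t ->
  (cox_mx s t = 0%N \/ (k <= cox_mx s t)%N) -> 0 <= cheb (- cox_form R s t) k.
Proof.
move=> st; have [m0 _|m0 [m00|km]] := posnP (cox_mx s t).
- by rewrite cox_form_infty// cheb1 ler0n.
- by rewrite m00 in m0.
- rewrite cox_form_cos// cheb_ge0// ltn_neqAle eq_sym.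
  by rewrite (cox_mx_neq1 WS st).
Qed.

(* Write w = v a with a an alternating word in s and the last letter t of w,
   lengths adding up and a as long as possible: then v is shortest in its coset
   of the dihedral group <s, t>, so induction applies to v, while the rank two
   computation applies to a. *)
Lemma geom_rep_nneg w s : (l w <= l (w * val s)%g)%N -> nneg (rho w (simple s)).
Proof.
have [n] := ubnP (l w); elim: n w s => // n IHn w s /ltnSE wn ws.
have [w0|w0] := posnP (l w).
  by rewrite (ell_eq0 w0) (geom_rep1 WS); apply: nneg_simple.
have [t wt [x0 x0w sx0]] := ell_descent w0.
have st : s != t by apply: contraTneq ws => ->; rewrite wt ltnn.
pose P k := `[< exists2 x : seq S, w = (word_prod x * word_prod (alt s t k))%g &
                           (size x + k)%N = l w >].
have bdP k : P k -> (k <= l w)%N.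
  by move=> /asboolP[x _ <-]; rewrite leq_addl.
have P1 : P 1%N.
  apply/asboolP; exists x0; last by rewrite sx0 wt addn1.
  by rewrite -x0w -cats1 word_prod_cat.
case: (ex_maxnP (ex_intro P _ P1) bdP) => k /asboolP[x wx szx] kmax.
have k0 : (0 < k)%N := kmax _ P1.
set v := word_prod x in wx.
have lv : l v = size x.
  apply/eqP; rewrite eqn_leq ell_word_le /= -(leq_add2r k) szx {1}wx.
  by rewrite (leq_trans (ell_mul_word _ _))// size_alt.
have [k' ek] : exists k', k = k'.+1 by exists k.-1; rewrite prednK.
set p := if odd k' then s else t; set q := if odd k' then t else s.
(* [p] is the first letter of the alternating part. Were v p shorter than v, w would have a word
   shorter than its length. *)
have hp : (l v <= l (v * val p)%g)%N.
  rewrite leqNgt; apply/negP => vp.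
  have := ell_mul_word (v * val p)%g (alt s t k').
  have -> : (v * val p * word_prod (alt s t k'))%g = w.
    by rewrite wx ek /= word_prod_cons mulgA.
  by rewrite size_alt; lia.
(* [q] is the letter prolonging the alternating part to the left. Were v q shorter than v, k would
   not be maximal. *)
have hq : (l v <= l (v * val q)%g)%N.
  rewrite leqNgt; apply/negP => vq.
  have [y ey sy] := ell_word (v * val q)%g.
  have wy : w = (word_prod y * word_prod (alt s t k.+1))%g.
    rewrite ey /= word_prod_cons (_ : (if odd k then s else t) = q).
      by rewrite mulgA mulg_valK.
    by rewrite /q ek /=; case: odd.
  have := ell_mul_word (word_prod y) (alt s t k.+1).
  have := ell_word_le y.
  rewrite -wy size_alt => h1 h2.
  rewrite -sy lv in vq.
  have /kmax : P k.+1 by apply/asboolP; exists y => //; lia.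
  by rewrite ltnn.
have hs : nneg (rho v (simple s)).
  apply: IHn; first by lia.
  by move: hp hq; rewrite /p /q; case: odd.
have ht : nneg (rho v (simple t)).
  apply: IHn; first by lia.
  by move: hp hq; rewrite /p /q; case: odd.
(* If k were at least m, appending s would give an alternating word of k + 1 letters that can be
   rewritten with fewer than k, making w s shorter than w. *)
have km : cox_mx s t = 0%N \/ (k.+1 <= cox_mx s t)%N.
  have [->|m0] := posnP (cox_mx s t); first by left.
  right; rewrite ltnNge; apply/negP => mk.
  have [y ey sy] := ell_alt_le m0 mk.
  have := ell_mul_word v y.
  rewrite -ey -rcons_alt word_prod_rcons mulgA -wx => /(leq_trans ws).
  by rewrite -szx lv leq_add2l leqNgt sy.
have km' : cox_mx s t = 0%N \/ (k <= cox_mx s t)%N.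
  by case: km => [|/ltnW]; [left|right].
rewrite wx (geom_repM WS) (geom_rep_word WS) (act_alt R WS).
rewrite (geom_repP_linear WS) (geom_repZ WS).
by apply: nnegD; apply: nnegZ; rewrite ?cheb_cox_ge0//; case: odd.
Qed.

Lemma geom_rep_npos w s : (l (w * val s)%g <= l w)%N -> nneg (- rho w (simple s)).
Proof.
move=> ws; have := @geom_rep_nneg (w * val s)%g s.
rewrite mulg_valK (geom_repM WS) (geom_rep_simple WS) simple_reflE.
rewrite (reflv_self (bilin_simple1 R WS s)) (geom_repN WS); exact.
Qed.

(** A nontrivial w has a descent s, so it makes the root of s negative and cannot fix it. *)
Lemma geom_rep_faithful w : (forall v, rho w v = v) -> w = 1%g.
Proof.
move=> wid; have [/ell_eq0//|/ell_descent[s ws _]] := posnP (l w).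
have := @geom_rep_npos w s; rewrite ws leqnSn => /(_ isT).
rewrite wid => /(nneg_anti (nneg_simple s)) s0.
have := bilin_simple1 R WS s; rewrite s0 bilin0l => /esym/eqP.
by rewrite oner_eq0.
Qed.

Lemma geom_rep_inj w w' : (forall v, rho w v = rho w' v) -> w = w'.
Proof.
move=> ww'; apply: (@mulgI _ (w'^-1)%g); rewrite mulVg.
by apply: geom_rep_faithful => v; rewrite (geom_repM WS) ww' (geom_repK WS).
Qed.

End Length.

(** * Reflections in arbitrary roots *)

Section Roots.
Context (R : realType) (W : groupType) (S : set W).
Hypothesis WS : coxeter_system S.
Local Notation V := (geom_space R S).
Local Notation srefl := (@simple_refl R W S).
Local Notation simple := (simple_root R).
Local Notation rho := (@geom_rep R W S).
Local Notation l := (@ell W S).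
Local Notation roots := (@Defs.roots R W S).
Local Notation refl := (@Defs.refl R W S).
Implicit Types (s t : S) (a b v : V) (w : W).

Lemma roots_geom_rep w a : roots a -> roots (rho w a).
Proof.
by move=> [w' [s ->]]; exists (w * w')%g, s; rewrite (geom_repM WS).
Qed.

Lemma root_simple s : roots (simple s).
Proof. by exists 1%g, s; rewrite (geom_rep1 WS). Qed.

Lemma bilin_root a : roots a -> bilin a a = 1.
Proof.
by move=> [w [s ->]]; rewrite (geom_rep_bilin WS) (bilin_simple1 R WS).
Qed.

Lemma root_sign a : roots a -> nneg a \/ nneg (- a).
Proof.
move=> [w [s ->]]; have [/ltnW ws|ws] := ltnP (l w) (l (w * val s)%g).
  by left; apply: (geom_rep_nneg R WS).
by right; apply: (geom_rep_npos R WS).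
Qed.

Lemma root_nneg_anti a : roots a -> nneg a -> ~ nneg (- a).
Proof.
move=> ra a0 /(nneg_anti a0) e; have := bilin_root ra.
by rewrite e bilin0l => /esym/eqP; rewrite oner_eq0.
Qed.

(** Any w and s that [refl] may pick act as the reflection in a, so the choice does not matter. *)
Lemma refl_reflv a v : roots a -> rho (refl a) v = reflv a v.
Proof.
move=> [w0 [s0 aE]]; rewrite /refl; case: xgetP => [r _ [w [s [-> ->]]]|].
  rewrite !(geom_repM WS) (geom_rep_simple WS) simple_reflE.
  by rewrite (geom_rep_reflv WS) (geom_repVK WS).
by move=> /(_ (w0 * val s0 * w0^-1)%g) []; exists w0, s0.
Qed.

Lemma refl_geom_rep w a : roots a -> refl (rho w a) = (w * refl a * w^-1)%g.
Proof.
move=> ra; apply: (geom_rep_inj (R := R) WS) => v.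
rewrite refl_reflv; last exact: roots_geom_rep.
by rewrite !(geom_repM WS) refl_reflv// (geom_rep_reflv WS) (geom_repVK WS).
Qed.

Lemma refl_simple s : refl (simple s) = val s.
Proof.
apply: (geom_rep_inj (R := R) WS) => v; rewrite refl_reflv; last exact: root_simple.
by rewrite (geom_rep_simple WS).
Qed.

Lemma refl_sq a : roots a -> (refl a * refl a)%g = 1%g.
Proof.
move=> ra; apply: (geom_rep_faithful (R := R) WS) => v.
by rewrite (geom_repM WS) !refl_reflv// reflvK//; apply: bilin_root.
Qed.

Lemma refl_neq1 a : roots a -> refl a != 1%g.
Proof.
move=> [w [s ->]]; rewrite refl_geom_rep ?refl_simple; last exact: root_simple.
apply: contra (val_neq1 WS s) => /eqP e; apply/eqP.
by apply: (@mulgI _ w); apply: (@mulIg _ w^-1%g); rewrite e mulg1 mulgV.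
Qed.

(** Comparing the images of a makes a a multiple of b, by 1 or -1 since both have norm one.
    Positivity excludes -1. *)
Lemma refl_inj a b : pos_roots a -> pos_roots b -> refl a = refl b -> a = b.
Proof.
move=> [ra a0] [rb b0] ab.
have : reflv a a = reflv b a by rewrite -!refl_reflv// ab.
rewrite reflv_self ?bilin_root// /reflv; set d := bilin a b => e.
have aE : a = d *: b.
  have /(congr1 (fun v => 2^-1 *: (a - v))) := e.
  by rewrite opprK opprB addrCA subrr addr0 scalerA mulKf ?pnatr_eq0// -mulr2n
    -scaler_nat scalerA mulVf ?pnatr_eq0// scale1r.
have : d ^+ 2 = 1.
  by rewrite -(bilin_root ra) [in RHS]aE bilinZl bilinZr// bilin_root// mulr1.
move=> /eqP; rewrite sqrf_eq1 => /orP[] /eqP d1; first by rewrite aE d1 scale1r.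
case: (root_nneg_anti ra a0) => s.
by rewrite aE d1 scaleN1r opprK.
Qed.

(** The reflection alters only the coefficient at s, so all others vanish, and the normalisation
    leaves just the simple root. *)
Lemma simple_refl_neg s a : pos_roots a -> nneg (- srefl s a) -> a = simple s.
Proof.
move=> [ra a0] Na.
have az t : t != s -> coeff t a = 0.
  move=> ts; apply/eqP; rewrite eq_le a0 andbT.
  have := Na t; rewrite /simple_refl coeffN coeffB coeffZ coeffU.
  by rewrite eq_sym (negbTE ts) !mulr0 subr0 oppr_ge0.
have aE : a = coeff s a *: simple s.
  apply/eqP/freeg_eqP => t; rewrite coeffZ coeffU mul1r.
  by have [->|/az ->] := eqVneq t s; rewrite ?eqxx ?mulr1 ?mulr0.
have : coeff s a ^+ 2 = 1.
  by rewrite -(bilin_root ra) [in RHS]aE bilinZl bilinZr// (bilin_simple1 R WS) mulr1.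
move=> /eqP; rewrite sqrf_eq1 => /orP[] /eqP c1; first by rewrite aE c1 scale1r.
by have := a0 s; rewrite c1 oppr_ge0 ler10.
Qed.

(** Some letter turns the image of a from positive to negative. Just before it the image is the
    simple root of that letter, so multiplying by [refl a] deletes the letter. *)
Lemma strong_exchange (x : seq S) a : pos_roots a -> nneg (- rho (word_prod x) a) ->
  exists2 y : seq S, word_prod y = (word_prod x * refl a)%g & (size y < size x)%N.
Proof.
move=> pa; have [ra a0] := pa; elim: x => [|s x IHx].
  by rewrite word_prod_nil (geom_rep1 WS) => /(root_nneg_anti ra a0).
rewrite word_prod_cons (geom_repM WS) (geom_rep_simple WS) => neg.
have rx : roots (rho (word_prod x) a) by exact: roots_geom_rep.
have [pos|/IHx[y ey sy]] := root_sign rx; last first.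
  by exists (s :: y); rewrite ?word_prod_cons ?ey ?mulgA.
exists x => //.
have xa : rho (word_prod x) a = simple s by apply: simple_refl_neg.
have : (word_prod x * refl a * (word_prod x)^-1)%g = val s.
  by rewrite -refl_geom_rep// xa refl_simple.
by rewrite -mulgA => <-; rewrite -!mulgA mulKg (refl_sq ra) mulg1.
Qed.

Lemma ell_refl_lt w a : pos_roots a -> nneg (- rho w a) ->
  (l (w * refl a)%g < l w)%N.
Proof.
have [x <- <-] := ell_word WS w => pa /(strong_exchange pa)[y <-].
exact: leq_ltn_trans (ell_word_le WS y).
Qed.

Lemma ell_refl_pos w a : pos_roots a -> (l w <= l (w * refl a)%g)%N ->
  nneg (rho w a).
Proof.
move=> pa wa; have [//|/(ell_refl_lt pa)] := root_sign (roots_geom_rep w pa.1).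
by rewrite ltnNge wa.
Qed.

(** This is the preceding criterion for w s_a, since s_a negates a. *)
Lemma ell_refl_neg w a : pos_roots a -> (l (w * refl a)%g <= l w)%N ->
  nneg (- rho w a).
Proof.
move=> pa wa; have := @ell_refl_pos (w * refl a)%g a pa.
rewrite -mulgA refl_sq ?mulg1; last exact: pa.1.
rewrite (geom_repM WS) refl_reflv; last exact: pa.1.
rewrite reflv_self; last by apply: bilin_root; exact: pa.1.
by rewrite (geom_repN WS); apply.
Qed.

(** * The two inclusions *)

Lemma pbr_closure_sub A : A `<=` @pos_roots R W S -> A `<=` pbr_closure A.
Proof.
move=> hA a Aa; split; first exact: hA.
exists [:: a]; split => //=.
- by move=> c; rewrite inE => /eqP ->.
- by rewrite big_seq1.
- rewrite big_seq1 andbT lt0n; apply: contra (refl_neq1 (hA _ Aa).1).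
  by move=> /eqP/(ell_eq0 WS) ->.
Qed.

Lemma prod_refl_rev (b : seq V) : (forall c, c \in b -> roots c) ->
  (\prod_(c <- rev b) refl c = (\prod_(c <- b) refl c)^-1)%g.
Proof.
elim: b => [|a b IHb] rb; first by rewrite !big_nil invg1.
rewrite rev_cons -cats1 big_cat big_seq1 big_cons invgM IHb; last first.
  by move=> c cb; apply: rb; rewrite inE cb orbT.
congr (_ * _)%g; apply: (@mulgI _ (refl a)).
by rewrite mulgV refl_sq//; apply: rb; rewrite inE eqxx.
Qed.

Lemma pbr_closure_two A : A `<=` @pos_roots R W S ->
  pbr_closure A `<=` two_closure A.
Proof.
move=> hA a [pa [b [bA ab incr pal]]] C [hC [C2 AC]].
have rb c : c \in b -> roots c by move=> /bA/hA[].
have [ra a0] := pa.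
set n := size b in incr.
pose X r := (\prod_(c <- take r b) refl c)%g.
have X0 : X 0%N = 1%g by rewrite /X take0 big_nil.
have Xn : X n = refl a by rewrite /X take_size ab.
have XS r : (r < n)%N -> X r.+1 = (X r * refl (nth 0 b r))%g.
  by move=> rn; rewrite /X (take_nth 0 rn) -cats1 big_cat big_seq1.
have Xlt i j : (i < j)%N -> (j <= n)%N -> (l (X i) < l (X j))%N.
  move=> ij jn.
  (* The initial 0 of the chain condition is the length of [X 0], so the chain may start at index
     0. *)
  have srt : sorted ltn [seq l (X r) | r <- iota 0 n.+1].
    by rewrite /= X0 (ell1 WS).
  have := sorted_ltn_nth ltn_trans 0%N srt.
  rewrite size_map size_iota => /(_ i j).
  rewrite !inE !(nth_map 0%N) ?size_iota; try lia.
  by rewrite !nth_iota ?add0n; try lia; apply; lia.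
(* Since [b] is a palindrome, its last r factors multiply to the inverse of [X r]. *)
have Xpal r : (r <= n)%N -> X (n - r)%N = (refl a * X r)%g.
  move=> rn; rewrite -Xn.
  have -> : X n = (X (n - r)%N * (X r)^-1)%g.
    rewrite /X take_size -[b in LHS](cat_take_drop (n - r)) big_cat.
    congr (_ * _)%g; rewrite -prod_refl_rev; last by move=> c /mem_take/rb.
    by rewrite -[b in LHS]pal drop_rev subKn.
  by rewrite -mulgA mulVg mulg1.
have [k nk] : exists k, n = k.*2.+1.
  have [on|en] := boolP (odd n).
    by exists n./2; rewrite -[LHS]odd_double_half on.
  case/negP: (refl_neq1 ra); apply/eqP.
  have := Xpal n./2; rewrite (_ : (n - n./2 = n./2)%N); last first.
    by have := odd_double_half n; rewrite (negbTE en); lia.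
  by move=> h; apply: (@mulIg _ (X n./2)); rewrite mul1g -h//; lia.
pose be r := rho (X r)^-1%g a.
(* The sign criterion multiplies on the right, so it is applied to the inverses of x_r and s_alpha
   x_r = x_(n-r), where r < n - r. *)
have bpos r : (r <= k)%N -> pos_roots (be r).
  move=> rk; split; first exact: roots_geom_rep.
  apply: ell_refl_pos => //; rewrite (ellV WS) ltnW//.
  rewrite -[X in (_ < X)%N](ellV WS) invgM invgK.
  have -> : ((refl a)^-1 = refl a)%g.
    by apply: (@mulgI _ (refl a)); rewrite mulgV refl_sq.
  by rewrite -Xpal; [apply: Xlt|]; lia.
suff Cb j : (j <= k)%N -> C (be (k - j)%N).
  by have := Cb k (leqnn k); rewrite subnn /be X0 invg1 (geom_rep1 WS).
have bn r : (r < n)%N -> A (nth 0 b r) by move=> rn; apply/bA/mem_nth.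
elim: j => [_|j IHj jk].
  rewrite subn0; have kn : (k < n)%N by lia.
  suff -> : be k = nth 0 b k by apply/AC/bn.
  (* Since x_(k+1) = s_alpha x_k, conjugating s_alpha by x_k^-1 gives the middle reflection. *)
  apply: refl_inj; [exact: bpos | exact/hA/bn | ].
  rewrite refl_geom_rep// invgK -mulgA -Xpal; last lia.
  rewrite (_ : (n - k = k.+1)%N); last lia.
  by rewrite XS// mulKg.
have := IHj (ltnW jk); set r := (k - j.+1)%N.
have -> : (k - j = r.+1)%N by lia.
have rn : (r < n)%N by lia.
set c := nth 0 b r => Cr.
have Ac : A c by exact: bn.
have pc : pos_roots c by exact: hA.
have c1 : bilin c c = 1 by apply: bilin_root; exact: pc.1.
have beS : be r.+1 = reflv c (be r).
  rewrite /be XS// invgM (geom_repM WS) -/c -refl_reflv; last exact: pc.1.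
  congr rho; apply: (@mulgI _ (refl c)).
  by rewrite mulgV refl_sq//; exact: pc.1.
have bec : 0 <= bilin (be r) c.
  have -> : bilin (be r) c = bilin a (rho (X r) c).
    by rewrite -(geom_rep_bilin WS (X r)) /be (geom_repVK WS).
  set g := rho (X r) c.
  have g0 : nneg g by apply: ell_refl_pos => //; rewrite -XS// ltnW// Xlt.
  (* Here s_alpha x_r = x_(n-r) is longer than s_alpha x_(r+1) = x_(n-r-1). *)
  have : nneg (- reflv a g).
    rewrite -refl_reflv// -(geom_repM WS); apply: ell_refl_neg => //.
    rewrite -mulgA -XS// -!Xpal; try lia.
    by apply/ltnW/Xlt; lia.
  (* A negative product would make the reflection of [g] a nonnegative combination of [g] and
     [a]. *)
  rewrite leNgt => Ng; apply/negP => ag; apply: (root_nneg_anti _ _ Ng).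
    by rewrite -refl_reflv//; do 2!apply: roots_geom_rep; exact: pc.1.
  rewrite /reflv -scaleNr; apply: nnegD => //; apply: nnegZ => //.
  by rewrite (bilinC WS) -mulrN mulr_ge0// oppr_ge0 ltW.
have beE : be r = 1 *: be r.+1 + (2 * bilin (be r) c) *: c.
  by rewrite beS /reflv; freeg_ring.
rewrite beE; apply: C2 => //; first exact: AC.
- by rewrite mulr_ge0.
- by rewrite -beE; apply: bpos; lia.
Qed.

End Roots.

Theorem theorem1p4 (R : realType) (W : groupType) (S : set W)
    (WS : coxeter_system S) (A : set (geom_space R S))
    (hA : A `<=` @pos_roots R W S) :
  A `<=` pbr_closure A /\ pbr_closure A `<=` two_closure A.
Proof.
split; first exact: pbr_closure_sub.
exact: pbr_closure_two.
Qed.
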